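(* Let $G$ be a pseudo-outerplanar graph with minimum degree at least $2$. Then $G$ contains at least one of the following configurations (where $d(\cdot)$ denotes degree in $G$): (a) a vertex $u$ with $d(u)=2$ adjacent to a vertex $v$ with $d(v)\leq 4$; (b) a path $v_1u_1v_2u_2v_3u_3v_4$ such that $v_1v_2,v_1v_3,v_2v_3,v_2v_4,v_3v_4\in E(G)$, $d(u_1)=d(u_2)=d(u_3)=2$ and $d(v_2)=d(v_3)=5$; (c) a cycle $u_1u_2u_3u_4$ with $d(u_2)=d(u_4)=2$; (d) a cycle $u_1u_2u_3u_4$ with $u_2u_4\in E(G)$, $d(u_2)=d(u_4)=3$ and $d(u_3)\leq 4$; (e) a cycle $u_1u_2u_3u_4$ with $u_2u_4\in E(G)$, $d(u_2)=d(u_4)=3$, and $u_3$ adjacent to a vertex $v$ with $d(v)=2$; (f) a cycle $u_1u_2u_3u_4$ with $u_2u_4\in E(G)$, $d(u_2)=d(u_4)=3$, and $u_3$ adjacent to a vertex $v$ with $d(v)=3$ and to a vertex $x$ with $vx\in E(G)$; (g) a cycle $u_1u_2u_3u_4$ with $u_1u_3,u_2u_4\in E(G)$, $d(u_2)=d(u_4)=3$, and $u_3$ adjacent to a vertex $v$ with $u_1v\in E(G)$.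
   Context: All graphs are finite, simple and undirected. A graph is pseudo-outerplanar if each of its blocks has an embedding in the plane so that the vertices lie on a fixed circle and the edges lie inside the disk of this circle with each edge crossing at most one other edge. *)

(* Defs.v *)
From HB Require Import structures.
From mathcomp Require Import all_boot all_order all_algebra.
From mathcomp Require Import classical_sets reals topology normedtype.

Set Implicit Arguments.
Unset Strict Implicit.
Unset Printing Implicit Defensive.

Import Order.TTheory GRing.Theory Num.Theory.
Import numFieldNormedType.Exports.

Local Open Scope ring_scope.

Section Graph.
Variables (T : finType) (e : rel T).

Definition deg (x : T) : nat := #|[set y | e x y]|.

Definition induced (S : {set T}) : rel T :=
  [rel x y | [&& x \in S, y \in S & e x y]].

Definition edges_in (S : {set T}) : {set {set T}} :=
  [set [set x; y] | x in S, y in S & e x y].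

Definition connected_in (S : {set T}) : bool :=
  [forall x in S, forall y in S, connect (induced S) x y].

Definition cutvertex (S : {set T}) (v : T) : bool :=
  (v \in S) && ~~ connected_in (S :\ v).

Definition nonseparable (S : {set T}) : bool :=
  [&& S != finset.set0, connected_in S & [forall v, ~~ cutvertex S v]].

(* A maximal connected subgraph without a cut vertex is an induced subgraph,
   so a block is represented by its vertex set. *)
Definition block (S : {set T}) : bool := maxset nonseparable S.

End Graph.

Section Drawing.
Variable R : realType.

Definition on_unit_circle (p : R * R) : Prop := p.1 ^+ 2 + p.2 ^+ 2 = 1.

Definition in_unit_disk (p : R * R) : Prop := p.1 ^+ 2 + p.2 ^+ 2 <= 1.

Definition simple_arc (p q : R * R) (A : set (R * R)) : Prop :=
  exists f : R -> R * R,
    [/\ {within `[0, 1], continuous f}%classic,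
        {in `[0, 1] &, injective f},
        f 0 = p, f 1 = q & A = (f @` `[0, 1])%classic].

Variables (T : finType) (e : rel T).

(* [pos] places the vertices; [curve] gives, for each edge {x, y}, the point
   set of the simple arc drawn for it.  Arcs may run along the circle, but
   contain no vertex other than their two ends. *)
Record circle_drawing (S : {set T}) (pos : T -> R * R)
    (curve : {set T} -> set (R * R)) : Prop := CircleDrawing {
  pos_circle : {in S, forall x, on_unit_circle (pos x)};
  pos_inj : {in S &, injective pos};
  curve_arc : {in S &, forall x y, e x y ->
    simple_arc (pos x) (pos y) (curve [set x; y])};
  curve_disk : forall E, E \in edges_in e S ->
    forall p, curve E p -> in_unit_disk p;
  curve_vertex : forall E, E \in edges_in e S ->
    {in S, forall z, curve E (pos z) -> z \in E}
}.

(* Two distinct edges cross when their arcs meet at a point which is not the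
   position of a vertex (hence not a common end). *)
Definition crosses (S : {set T}) (pos : T -> R * R)
    (curve : {set T} -> set (R * R)) (E F : {set T}) : Prop :=
  E <> F /\ exists p, [/\ curve E p, curve F p & {in S, forall z, pos z <> p}].

Definition pseudo_outerplanar : Prop :=
  forall S : {set T}, block e S ->
    exists pos : T -> R * R, exists curve : {set T} -> set (R * R),
      circle_drawing S pos curve /\
      {in edges_in e S & &, forall E F F', crosses S pos curve E F ->
         crosses S pos curve E F' -> F = F'}.

End Drawing.

Arguments pseudo_outerplanar R {T} e.

Section Configurations.
Variables (T : finType) (e : rel T).
Local Notation d := (deg e).

Definition config_a : Prop :=
  exists u v, [/\ e u v, d u = 2%N & (d v <= 4)%N].

Definition config_b : Prop :=
  exists v1 u1 v2 u2 v3 u3 v4,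
    [/\ path e v1 [:: u1; v2; u2; v3; u3; v4],
        uniq [:: v1; u1; v2; u2; v3; u3; v4],
        [/\ e v1 v2, e v1 v3, e v2 v3, e v2 v4 & e v3 v4],
        [/\ d u1 = 2%N, d u2 = 2%N & d u3 = 2%N] &
        d v2 = 5%N /\ d v3 = 5%N].

Definition config_c : Prop :=
  exists u1 u2 u3 u4,
    [/\ ucycle e [:: u1; u2; u3; u4], d u2 = 2%N & d u4 = 2%N].

Definition diamond (u1 u2 u3 u4 : T) : Prop :=
  [/\ ucycle e [:: u1; u2; u3; u4], e u2 u4, d u2 = 3%N & d u4 = 3%N].

Definition config_d : Prop :=
  exists u1 u2 u3 u4, diamond u1 u2 u3 u4 /\ (d u3 <= 4)%N.

Definition config_e : Prop :=
  exists u1 u2 u3 u4 v, [/\ diamond u1 u2 u3 u4, e u3 v & d v = 2%N].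

(* In the next two configurations the extra vertices are new: otherwise
   v := u2 (with x := u4) would make them hold for every diamond, respectively
   for every diamond with the chord u1u3. *)
Definition config_f : Prop :=
  exists u1 u2 u3 u4 v x,
    [/\ diamond u1 u2 u3 u4, uniq [:: u1; u2; u3; u4; v; x],
        e u3 v /\ d v = 3%N, e u3 x & e v x].

Definition config_g : Prop :=
  exists u1 u2 u3 u4 v,
    [/\ diamond u1 u2 u3 u4, uniq [:: u1; u2; u3; u4; v],
        e u1 u3, e u3 v & e u1 v].

End Configurations.

(* Main.v *)
Require Import Defs.
From mathcomp Require Import all_boot all_order all_algebra.
From mathcomp Require Import reals.
From mathcomp Require Import zify ring lra.

Set Implicit Arguments.
Unset Strict Implicit.
Unset Printing Implicit Defensive.

(* Take an end block and number its vertices 0, ..., n-1 around the circle, 0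
   being its only possible cut vertex.  Two edges with interleaved ends have
   crossing arcs, so every edge is interleaved with at most one other edge.
   Call an interval [i, j] closed when no edge leaves its interior.  By
   induction on j - i, a closed interval either yields a configuration or is
   an edge (j = i+1), an ear (j = i+2, inner vertex of degree 2) or a diamond
   (j = i+3).  Indeed let w < j be maximal with [i, w] closed.  Either [w, j]
   is closed too, or [i, j] is spanned by two crossing edges i c and b j with
   i < b < c < j, and then [i, b], [b, c], [c, j] are closed; in both cases the
   smaller intervals are edges, ears or diamonds, which bounds the degrees of
   w, or of b and c.  The interval [0, n-1] is closed, and in the three small
   cases the vertex n-1 has degree at most 3.

   That arcs f from p1 to p3 and g from p2 to p4 in the disk meet when p1, p2,
   p3, p4 are in circular order follows from the Poincare-Miranda theorem for
   two functions of (f s, g t) which have the right signs on the border of the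
   unit square and vanish together only when f s = g t. *)

(** * Small intervals *)

Section Sides.
Variables (T : finType) (e : rel T).
Hypothesis e_sym : symmetric e.
Local Notation d := (deg e).

Definition reducible : Prop :=
  config_a e \/ config_b e \/ config_c e \/ config_d e \/
  config_e e \/ config_f e \/ config_g e.

Lemma deg_le_size w (L : seq T) : (forall y, e w y -> y \in L) -> d w <= size L.
Proof.
move=> h; apply: leq_trans (card_size L).
by apply: subset_leq_card; apply/subsetP => y; rewrite inE => /h.
Qed.

Lemma deg_eq_size w (L : seq T) : (forall y, e w y -> y \in L) ->
  size L <= d w -> {in L, forall y, e w y}.
Proof.
move=> h le_L y yL.
have sub : [set y | e w y] \subset [set y in L].
  by apply/subsetP => x; rewrite !inE => /h.
have: [set y | e w y] == [set y in L].
  rewrite eqEcard sub (leq_trans _ le_L) //.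
  by rewrite cardsE card_size.
by move/eqP/setP/(_ y); rewrite !inE yL.
Qed.

(* A small interval seen from its end [w]: [o] is its other end, and [L] lists
   the vertices of the interval other than [w]. *)
Variant side (w o : T) : seq T -> Prop :=
| SideEdge : side w o [:: o]
| SideEar u of d u = 2 & e w u : side w o [:: o; u]
| SideDiamond p q of diamond e o p w q : side w o [:: o; p; q].

Lemma diamond_reducible4 o p w q : diamond e o p w q -> d w <= 4 -> reducible.
Proof. by move=> D dw; right; right; right; left; exists o, p, w, q. Qed.

Lemma diamond_reducible_ear o p w q u :
  diamond e o p w q -> e w u -> d u = 2 -> reducible.
Proof. by move=> D wu du; do 4! right; left; exists o, p, w, q, u. Qed.

Lemma diamond_reducible_triangle o p w q r : diamond e o p w q ->
  uniq [:: o; p; w; q; r] -> e o w -> e w r -> e o r -> reducible.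
Proof. by move=> D U ow wr or_; do 6! right; exists o, p, w, q, r. Qed.

Lemma diamond_reducible_diamond o p w q o' p' q' :
  diamond e o p w q -> diamond e o' p' w q' ->
  uniq (w :: [:: o; p; q] ++ [:: o'; p'; q']) -> reducible.
Proof.
move=> D D' U; do 5! right; left; exists o, p, w, q, p', q'; split=> //.
- move: U; rewrite -(perm_uniq (_ : perm_eq (o' :: [:: o; p; w; q; p'; q']) _)).
    by case/andP.
  apply/permP => a /=; lia.
- by case: D' => /andP[/= /and5P[_ p'w _ _ _] _] _ dp' _; rewrite e_sym.
- by case: D' => /andP[/= /and5P[_ _ wq' _ _] _] _ _ _.
- by case: D'.
Qed.

Lemma ear_reducible u w : d u = 2 -> e w u -> d w <= 4 -> reducible.
Proof. by move=> du wu dw; left; exists u, w; rewrite e_sym. Qed.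

(** An ear beside an edge or an ear, and likewise an edge beside a diamond, leave [w] degree at most
    4: configurations (a) and (d). An ear beside a diamond gives (e), two diamonds give (f). *)
Lemma sides_reducible w i j Li Lj : side w i Li -> side w j Lj ->
  (forall y, e w y -> y \in Li ++ Lj) -> uniq (w :: Li ++ Lj) ->
  reducible \/ Li = [:: i] /\ Lj = [:: j].
Proof.
move=> si sj nw U; have dw := deg_le_size nw.
case: si sj nw U dw => [|u du wu|p q D] [|u' du' wu'|p' q' D'] nw U dw.
- by right.
- by left; apply: (ear_reducible du' wu'); apply: leq_trans dw _.
- by left; apply: (diamond_reducible4 D').
- by left; apply: (ear_reducible du wu); apply: leq_trans dw _.
- by left; apply: (ear_reducible du wu).
- by left; apply: (diamond_reducible_ear D' wu du).
- by left; apply: (diamond_reducible4 D).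
- by left; apply: (diamond_reducible_ear D wu' du').
- by left; apply: (diamond_reducible_diamond D D').
Qed.

(** The extra vertex [z] raises the degree bound by one. Two ears may now leave [b] of degree 5,
    which is half of configuration (b). So may an edge beside a diamond, but then all candidates are
    neighbours of [b], and with the edge [a c] they form the triangle of (g). *)
Lemma crossed_sides_reducible b a c z La Lc : side b a La -> side b c Lc ->
  e a c -> (forall y, e b y -> y \in z :: La ++ Lc) ->
  uniq (b :: z :: La ++ Lc) ->
  [\/ reducible, La = [:: a] /\ Lc = [:: c] |
      exists u u', [/\ La = [:: a; u], Lc = [:: c; u'], d u = 2, d u' = 2 &
                       d b = 5 /\ {in z :: La ++ Lc, forall y, e b y}]].
Proof.
move=> sa sc ac nb U; have db := deg_le_size nb; have ab := deg_eq_size nb.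
case: sa sc nb U db ab => [|u du bu|p q D] [|u' du' bu'|p' q' D'] nb U db ab;
  try (by constructor 2).
- by constructor 1; apply: (ear_reducible du' bu').
- constructor 1; have [/(diamond_reducible4 D')//|db5] := leqP (d b) 4.
  have {}ab := ab db5.
  apply: (diamond_reducible_triangle (r := a) D').
  + move: U; rewrite -(perm_uniq (_ : perm_eq (z :: [:: c; p'; b; q'; a]) _)).
      by case/andP.
    apply/permP => x /=; lia.
  + by rewrite e_sym ab // !inE eqxx ?orbT.
  + by rewrite ab // !inE eqxx ?orbT.
  + by rewrite e_sym.
- by constructor 1; apply: (ear_reducible du bu).
- have [db4|db5] := leqP (d b) 4.
    by constructor 1; apply: (ear_reducible du bu).
  constructor 3; exists u, u'; split=> //; split; last exact: ab.
  by apply/eqP; rewrite eqn_leq db db5.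
- by constructor 1; apply: (diamond_reducible_ear D' bu du).
- constructor 1; have [/(diamond_reducible4 D)//|db5] := leqP (d b) 4.
  have {}ab := ab db5.
  apply: (diamond_reducible_triangle (r := c) D).
  + move: U; rewrite -(perm_uniq (_ : perm_eq (z :: [:: a; p; b; q; c]) _)).
      by case/andP.
    apply/permP => x /=; lia.
  + by rewrite e_sym ab // !inE eqxx ?orbT.
  + by rewrite ab // !inE eqxx ?orbT.
  + by [].
- by constructor 1; apply: (diamond_reducible_ear D bu' du').
- constructor 1; apply: (diamond_reducible_diamond D D').
  move: U.
  rewrite (perm_uniq (_ : perm_eq _ (z :: b :: [:: a; p; q] ++ [:: c; p'; q']))).
    by case/andP.
  by apply/permP => x /=; lia.
Qed.

End Sides.

Definition interleaved (a c b d : nat) : bool :=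
  [&& a < b, b < c & c < d] || [&& b < a, a < d & d < c].

Lemma gapE a b k : a < b -> b - a = k -> b = a + k.
Proof. by move=> /ltnW ab <-; rewrite subnKC. Qed.

(** * Closed intervals of the circular order *)

Section Intervals.
Variables (T : finType) (e : rel T).
Hypotheses (e_sym : symmetric e) (e_irr : irreflexive e).
Hypothesis min_deg : forall x, 2 <= deg e x.
Local Notation d := (deg e).

(* [v 0, ..., v n.-1] are the vertices of an end block in circular order, the
   vertex at which the block may be attached to the rest being [v 0]. *)
Variables (n : nat) (v : nat -> T).
Hypothesis v_inj : {in gtn n &, injective v}.
Hypothesis v_nbr : forall k y, 0 < k < n -> e (v k) y -> exists2 m, m < n & y = v m.
Local Notation ed := (fun i j : nat => e (v i) (v j)).
Hypothesis one_crossing : forall a c b d b' d',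
  a < n -> c < n -> b < n -> d < n -> b' < n -> d' < n ->
  ed a c -> ed b d -> ed b' d' -> b < d -> b' < d' ->
  interleaved a c b d -> interleaved a c b' d' -> b = b' /\ d = d'.

Definition closed_interval (i j : nat) : bool :=
  [forall k : 'I_n, forall m : 'I_n, (i < k < j) ==> ed k m ==> (i <= m <= j)].

Lemma closed_intervalP i j : j < n ->
  reflect (forall k m, i < k < j -> m < n -> ed k m -> i <= m <= j)
          (closed_interval i j).
Proof.
move=> ltjn; apply: (iffP forallP) => [h k m ikj mn km | h k].
  have kn : k < n by lia.
  by have /forallP/(_ (Ordinal mn))/implyP/(_ ikj)/implyP/(_ km) := h (Ordinal kn).
by apply/forallP => m; apply/implyP => ikj; apply/implyP; apply: h.
Qed.

Lemma ed_sym i j : ed i j = ed j i. Proof. exact: e_sym. Qed.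

Lemma ed_neq i j : ed i j -> i <> j.
Proof. by move=> + eij; rewrite /= eij e_irr. Qed.

Lemma nbr_in (k : nat) (L : seq nat) : 0 < k < n ->
  (forall m, m < n -> ed k m -> m \in L) -> forall y, e (v k) y -> y \in map v L.
Proof.
move=> kn h y ky; have [m mn ym] := v_nbr kn ky.
by rewrite ym map_f // h // -ym.
Qed.

Lemma nbr_deg (k : nat) (L : seq nat) : 0 < k < n ->
  (forall m, m < n -> ed k m -> m \in L) -> d (v k) <= size L.
Proof. by move=> kn h; rewrite -(size_map v); apply: deg_le_size; apply: nbr_in. Qed.

Lemma nbr_all (k : nat) (L : seq nat) : 0 < k < n ->
  (forall m, m < n -> ed k m -> m \in L) -> size L <= d (v k) ->
  {in L, forall m, ed k m}.
Proof.
move=> kn h; rewrite -(size_map v) => hs m mL.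
by apply: (deg_eq_size (nbr_in kn h)) => //; apply: map_f.
Qed.

Lemma uniq_v (L : seq nat) : all (gtn n) L -> uniq L -> uniq (map v L).
Proof.
move=> /allP Ln UL; rewrite map_inj_in_uniq // => x y /Ln xn /Ln yn.
exact: v_inj.
Qed.

Definition ear_at (u : nat) : Prop := [/\ d (v u) = 2, ed u u.-1 & ed u u.+1].

Lemma closed_ear i : i.+2 < n -> closed_interval i i.+2 -> ear_at i.+1.
Proof.
move=> lin /(closed_intervalP _ lin) cl.
have nb m : m < n -> ed i.+1 m -> m \in [:: i; i.+2].
  move=> mn im; have := cl i.+1 m _ mn im; have := ed_neq im.
  by rewrite !inE; lia.
have d2 : d (v i.+1) = 2.
  by have := min_deg (v i.+1); have := @nbr_deg i.+1 _ _ nb; rewrite /=; lia.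
have al := @nbr_all i.+1 _ _ nb.
by split=> //; apply: al; rewrite ?d2 ?inE ?eqxx ?orbT //; lia.
Qed.

Definition diamond_at (i : nat) : Prop :=
  diamond e (v i) (v i.+1) (v i.+3) (v i.+2).

(** The two inner vertices have neighbours only in the interval. If they are not adjacent, both have
    degree 2 and (c) holds; if they are adjacent and one has degree 2, (a) holds; otherwise both
    have degree 3. *)
Lemma closed_diamond i : i.+3 < n -> closed_interval i i.+3 ->
  reducible e \/ diamond_at i.
Proof.
move=> lin /(closed_intervalP _ lin) cl.
have nb1 m : m < n -> ed i.+1 m -> m \in [:: i; i.+2; i.+3].
  move=> mn im; have := cl i.+1 m _ mn im; have := ed_neq im.
  by rewrite !inE; lia.
have nb2 m : m < n -> ed i.+2 m -> m \in [:: i; i.+1; i.+3].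
  move=> mn im; have := cl i.+2 m _ mn im; have := ed_neq im.
  by rewrite !inE; lia.
have d1 := @nbr_deg i.+1 _ _ nb1; have d2 := @nbr_deg i.+2 _ _ nb2.
have a1 := @nbr_all i.+1 _ _ nb1; have a2 := @nbr_all i.+2 _ _ nb2.
have [e12|ne12] := boolP (ed i.+1 i.+2); last first.
  have nb1' m : m < n -> ed i.+1 m -> m \in [:: i; i.+3].
    move=> mn im; have := nb1 m mn im; rewrite !inE.
    by case: (m =P i.+2) => [mE|_]; [subst m; rewrite im in ne12 | lia].
  have nb2' m : m < n -> ed i.+2 m -> m \in [:: i; i.+3].
    move=> mn im; have := nb2 m mn im; rewrite !inE.
    by case: (m =P i.+1) => [mE|_]; [subst m; rewrite e_sym im in ne12 | lia].
  have m1 := min_deg (v i.+1); have m2 := min_deg (v i.+2).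
  have a1' := @nbr_all i.+1 _ _ nb1' m1; have a2' := @nbr_all i.+2 _ _ nb2' m2.
  have b1 := @nbr_deg i.+1 _ _ nb1'; have b2 := @nbr_deg i.+2 _ _ nb2'.
  left; right; right; left; exists (v i), (v i.+1), (v i.+3), (v i.+2); split.
  - apply/andP; split; last first.
      by apply: (@uniq_v [:: i; i.+1; i.+3; i.+2]) => /=; rewrite ?inE; lia.
    rewrite /= (ed_sym i) (ed_sym i.+3).
    by rewrite !a1' ?a2' ?inE ?eqxx ?orbT //; lia.
  - by move: b1 => /=; lia.
  - by move: b2 => /=; lia.
have [d13|d13] := leqP 3 (d (v i.+1)); last first.
  left; apply: (@ear_reducible _ _ e_sym (v i.+1) (v i.+2)).
  - by have := min_deg (v i.+1); lia.
  - by rewrite e_sym.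
  - by move: d2 => /=; lia.
have [d23|d23] := leqP 3 (d (v i.+2)); last first.
  left; apply: (@ear_reducible _ _ e_sym (v i.+2) (v i.+1)) => //.
  - by have := min_deg (v i.+2); lia.
  - by move: d1 => /=; lia.
right; split=> //.
- apply/andP; split; last first.
    by apply: (@uniq_v [:: i; i.+1; i.+3; i.+2]) => /=; rewrite ?inE; lia.
  rewrite /= (ed_sym i) (ed_sym i.+3).
  by rewrite !a1 ?a2 ?inE ?eqxx ?orbT //; lia.
- by move: d1 => /=; lia.
- by move: d2 => /=; lia.
Qed.

(** Length 1 stands for an edge without asserting adjacency, since only possible neighbours are
    counted; the ear of length 2 comes from closedness. *)
Definition small_interval (i j : nat) : Prop :=
  [\/ j = i.+1, j = i.+2 | j = i.+3 /\ diamond_at i].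

Lemma diamond_rev o p w q : diamond e o p w q -> diamond e w q o p.
Proof.
move=> [/andP[cy un] pq dp dq]; split=> //; last by rewrite e_sym.
apply/andP; split; last first.
  by rewrite -(rot_uniq 2) /rot /= in un *; move: un; rewrite !inE; lia.
by move: cy => /= /and5P[op pw wq qo _]; rewrite wq qo op pw.
Qed.

Lemma small_side_right i j : j < n -> closed_interval i j -> small_interval i j ->
  side e (v j) (v i) (map v (iota i (j - i))).
Proof.
move=> jn cl [jE|jE|[jE D]]; subst j.
- by rewrite subSnn; constructor.
- have [d2 _ e2] := closed_ear jn cl.
  have -> : i.+2 - i = 2 by lia.
  by apply: SideEar; rewrite // e_sym.
- have -> : i.+3 - i = 3 by lia.
  by apply: SideDiamond.
Qed.

Lemma small_side_left i j : j < n -> closed_interval i j -> small_interval i j ->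
  side e (v i) (v j) (map v (rev (iota i.+1 (j - i)))).
Proof.
move=> jn cl [jE|jE|[jE D]]; subst j.
- by rewrite subSnn; constructor.
- have [d2 e1 _] := closed_ear jn cl.
  have -> : i.+2 - i = 2 by lia.
  by apply: SideEar; rewrite // e_sym.
- have -> : i.+3 - i = 3 by lia.
  by apply: SideDiamond; apply: diamond_rev.
Qed.

(** All neighbours of [w] lie in [[i, j]], so its two sides yield a configuration unless both have
    length 1, and then [[i, j]] has length 2. *)
Lemma closed_split i w j : i < w < j -> j < n -> closed_interval i j ->
  closed_interval i w -> small_interval i w ->
  closed_interval w j -> small_interval w j ->
  reducible e \/ small_interval i j.
Proof.
move=> iwj jn cl cl1 s1 cl2 s2.
have wn : w < n by lia.
have w0 : 0 < w < n by lia.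
case: (sides_reducible e_sym (small_side_right wn cl1 s1)
         (small_side_left jn cl2 s2)).
- rewrite -map_cat; apply: nbr_in => // m mn wm.
  have := closed_intervalP _ jn cl w m iwj mn wm; have := ed_neq wm.
  by rewrite mem_cat mem_rev !mem_iota; lia.
- rewrite -map_cat -map_cons; apply: uniq_v.
    apply/allP => m; rewrite inE mem_cat mem_rev !mem_iota /=; lia.
  rewrite /= mem_cat mem_rev !mem_iota cat_uniq rev_uniq !iota_uniq.
  apply/and4P; split=> //; try lia.
  by apply/hasPn => m; rewrite mem_rev /= !mem_iota; lia.
- by left.
case=> /(congr1 size); rewrite size_map size_iota => h1 /(congr1 size).
rewrite size_map size_rev size_iota => h2; right; constructor 2.
by move: h1 h2 => /=; lia.
Qed.

(** * Intervals spanned by two crossing edges *)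

Section Crossing.
Variables a b c z : nat.
Hypotheses (abcz : [&& a < b, b < c & c < z]) (zn : z < n).
Hypotheses (ac : ed a c) (bz : ed b z).

Let no_cross_ac p q : p < q -> q < n -> ed p q -> interleaved a c p q ->
  p = b /\ q = z.
Proof.
move=> pq qn epq h.
have := @one_crossing a c p q b z; rewrite /interleaved in h *.
by case=> //; lia.
Qed.

Let no_cross_bz p q : p < q -> q < n -> ed p q -> interleaved b z p q ->
  p = a /\ q = c.
Proof.
move=> pq qn epq h.
have := @one_crossing b z p q a c; rewrite /interleaved in h *.
by case=> //; lia.
Qed.

Let no_cross p q : p < n -> q < n -> ed p q ->
  [/\ (if p < q then interleaved a c p q else interleaved a c q p) ->
       (p = b /\ q = z) \/ (p = z /\ q = b) &
      (if p < q then interleaved b z p q else interleaved b z q p) ->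
       (p = a /\ q = c) \/ (p = c /\ q = a)].
Proof.
move=> pn qn epq; have := ed_neq epq.
case: ltngtP => // pq _; split.
- by move/(no_cross_ac pq qn epq); left.
- by move/(no_cross_bz pq qn epq); left.
- by rewrite ed_sym in epq; move/(no_cross_ac pq pn epq) => [-> ->]; right.
- by rewrite ed_sym in epq; move/(no_cross_bz pq pn epq) => [-> ->]; right.
Qed.

(** An edge leaving one of the four intervals from its interior is interleaved with [a c] or [b z],
    hence equal to the other of these two edges; but neither of them leaves an interval in that
    way. *)
Lemma crossing_closed : [&& closed_interval a z, closed_interval a b,
  closed_interval b c & closed_interval c z].
Proof.
have bn : b < n by lia.
have cn : c < n by lia.
apply/and4P; split; apply/closed_intervalP => // k m h mn km.
all: have kn : k < n by lia.
all: have [] := no_cross kn mn km; rewrite /interleaved; have := ed_neq km.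
all: by case: ltngtP; lia.
Qed.

Lemma crossing_nbr_b m : m < n -> ed b m -> (a <= m <= c) || (m == z).
Proof.
move=> mn bm; have bn : b < n by lia.
have [] := no_cross bn mn bm; rewrite /interleaved; have := ed_neq bm.
by case: ltngtP; lia.
Qed.

Lemma crossing_nbr_c m : m < n -> ed c m -> (b <= m <= z) || (m == a).
Proof.
move=> mn cm; have cn : c < n by lia.
have [] := no_cross cn mn cm; rewrite /interleaved; have := ed_neq cm.
by case: ltngtP; lia.
Qed.

Lemma crossing_nbrs_b y : e (v b) y ->
  y \in v z :: map v (iota a (b - a)) ++ map v (rev (iota b.+1 (c - b))).
Proof.
rewrite -map_cat -map_cons; apply: nbr_in => [|m mn bm]; first by lia.
have := crossing_nbr_b mn bm; have := ed_neq bm.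
by rewrite inE mem_cat mem_rev !mem_iota; lia.
Qed.

Lemma crossing_nbrs_c y : e (v c) y ->
  y \in v a :: map v (rev (iota c.+1 (z - c))) ++ map v (iota b (c - b)).
Proof.
rewrite -map_cat -map_cons; apply: nbr_in => [|m mn cm]; first by lia.
have := crossing_nbr_c mn cm; have := ed_neq cm.
by rewrite inE mem_cat mem_rev !mem_iota; lia.
Qed.

Lemma crossing_uniq_b : uniq [:: v b, v z &
  map v (iota a (b - a)) ++ map v (rev (iota b.+1 (c - b)))].
Proof.
rewrite -map_cat -!map_cons; apply: uniq_v.
  by apply/allP => m; rewrite !inE mem_cat mem_rev !mem_iota /=; lia.
rewrite /= inE !mem_cat !mem_rev !mem_iota cat_uniq rev_uniq !iota_uniq.
apply/and3P; split; [lia|lia|]; apply/and3P; split=> //.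
by apply/hasPn => m; rewrite mem_rev /= !mem_iota; lia.
Qed.

Lemma crossing_uniq_c : uniq [:: v c, v a &
  map v (rev (iota c.+1 (z - c))) ++ map v (iota b (c - b))].
Proof.
rewrite -map_cat -!map_cons; apply: uniq_v.
  by apply/allP => m; rewrite !inE mem_cat mem_rev !mem_iota /=; lia.
rewrite /= inE !mem_cat !mem_rev !mem_iota cat_uniq rev_uniq !iota_uniq.
apply/and3P; split; [lia|lia|]; apply/and3P; split=> //.
by apply/hasPn => m; rewrite mem_rev /= !mem_iota; lia.
Qed.

(** The vertices [c] and [b] are examined in turn. If neither yields a configuration at once, they
    agree on the length of [[b, c]]: either all three intervals have length 1 and [[a, z]] has
    length 3, or all three are ears and (b) appears. *)
Lemma crossing_reducible :
  small_interval a b -> small_interval b c -> small_interval c z ->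
  reducible e \/ small_interval a z.
Proof.
move=> s1 s2 s3; have /and4P[cl cl1 cl2 cl3] := crossing_closed.
have [ab [bc cz]] : a < b /\ b < c /\ c < z by move/and3P: abcz => [].
have cn := ltn_trans cz zn; have bn := ltn_trans bc cn.
have zb : ed z b by rewrite ed_sym.
(* At [c] the picture is mirrored: the crossing edge is [z b] and the extra neighbour is [a]. *)
case: (crossed_sides_reducible e_sym (small_side_left zn cl3 s3)
         (small_side_right cn cl2 s2) zb crossing_nbrs_c crossing_uniq_c);
  first by left.
  case=> /(congr1 size) + /(congr1 size).
  rewrite !size_map size_rev !size_iota /= => c1 c2.
  case: (crossed_sides_reducible e_sym (small_side_right bn cl1 s1)
           (small_side_left cn cl2 s2) ac crossing_nbrs_b crossing_uniq_b);
  first by left.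
    case=> /(congr1 size) + _; rewrite size_map size_iota /= => b1.
    have zE : z = a.+3 by rewrite (gapE cz c1) (gapE bc c2) (gapE ab b1) !addn1.
    have zn' := zn; rewrite zE in cl zn' *.
    have [|D] := closed_diamond zn' cl; first by left.
    by right; constructor 3.
  case=> u [u' [_ /(congr1 size) + _ _ _]].
  by rewrite size_map size_rev size_iota c2.
case=> u [u' [/(congr1 size) + /(congr1 size) + _ _ [dc5 allc]]].
rewrite !size_map size_rev !size_iota /= => c1 c2.
case: (crossed_sides_reducible e_sym (small_side_right bn cl1 s1)
         (small_side_left cn cl2 s2) ac crossing_nbrs_b crossing_uniq_b);
  first by left.
  by case=> _ /(congr1 size); rewrite size_map size_rev size_iota c2.
case=> w [w' [/(congr1 size) + _ _ _ [db5 allb]]].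
rewrite size_map size_iota /= => b1.
have e_ba : ed b a.
  by apply: allb; rewrite inE mem_cat map_f ?orbT // mem_iota leqnn subnKC // ltnW.
have e_bc : ed b c.
  apply: allb; rewrite inE mem_cat [X in _ || (_ || X)]map_f ?orbT //.
  by rewrite mem_rev mem_iota bc addSn subnKC ?ltnSn // ltnW.
have e_cz : ed c z.
  apply: allc; rewrite inE mem_cat map_f ?orbT //.
  by rewrite mem_rev mem_iota cz addSn subnKC ?ltnSn // ltnW.
(* Three ears make seven consecutive vertices from [a] to [z], with [b] and [c] in third and fifth
   place: in this order they are the path of (b). *)
have bE : b = a.+2 by rewrite (gapE ab b1) addn2.
have cE : c = a.+4 by rewrite (gapE bc c2) bE addn2.
have zE : z = a.+4.+2 by rewrite (gapE cz c1) cE addn2.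
move: cl1 cl2 cl3 zn bn cn db5 dc5 ac bz e_ba e_bc e_cz; rewrite bE cE zE.
move=> cl1 cl2 cl3 zn' bn' cn' db5 dc5 ac' bz' e_ba e_bc e_cz.
have [u1d u1l u1r] := closed_ear bn' cl1.
have [u2d u2l u2r] := closed_ear cn' cl2.
have [u3d u3l u3r] := closed_ear zn' cl3.
left; right; left.
exists (v a), (v a.+1), (v a.+2), (v a.+3), (v a.+4), (v a.+4.+1), (v a.+4.+2).
split=> //.
- rewrite /= in u1l u1r u2l u2r u3l u3r *.
  by rewrite u1r u2r u3r e_sym u1l e_sym u2l e_sym u3l.
- apply: (@uniq_v (iota a 7)); rewrite ?iota_uniq //.
  apply/allP => m; rewrite mem_iota => /andP[_ /leq_trans]; apply.
  by rewrite -[7]/(6.+1) addnS -!addSnnS addn0.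
- by split=> //; rewrite e_sym.
Qed.

End Crossing.

Lemma closed_reducible_or_small i j : i < j -> j < n -> closed_interval i j ->
  reducible e \/ small_interval i j.
Proof.
have [k] := ubnP (j - i); elim: k i j => // k IH i j ltk ij jn cl.
have clP := closed_intervalP _ jn cl.
have [ji|ltij] := leqP j i.+1.
  by right; constructor 1; lia.
pose P w := (i < w < j) && closed_interval i w.
have exP : exists w, P w.
  exists i.+1; rewrite /P ltnSn ltij /=.
  by apply/closed_intervalP => [|x m]; lia.
have ubP w : P w -> w <= j by rewrite /P; lia.
case: (ex_maxnP exP ubP) => w /andP[iwj clw] maxw.
have wn : w < n by lia.
have sub p q : i <= p -> p < q -> q <= j -> (i < p) || (q < j) ->
    closed_interval p q -> reducible e \/ small_interval p q.
  by move=> ip pq qj lt clpq; apply: IH => //; lia.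
case: (boolP [exists x : 'I_n, (w < x < j) && ed i x]).
  case/existsP => -[x xn] /= /andP[wxj ix].
  (* By maximality of [w] the interval [[i, x]] is not closed, so an edge [p m] leaves its interior;
     it stays within [[i, j]], hence crosses the edge [i x]. *)
  have: ~~ closed_interval i x.
    by apply/negP => clx; have := maxw x; rewrite /P clx; lia.
  case/forallPn => -[p pn] /forallPn[] [m mn] /=.
  rewrite !negb_imply => /and3P[ipx pm nim].
  have := clP p m _ mn pm => /(_ _)/wrap[|him]; first by lia.
  have cr : [&& i < p, p < x & x < m] by lia.
  have /and4P[clm cl1 cl2 cl3] := crossing_closed cr mn ix pm.
  (* The interval [[i, m]] is closed and longer than [[i, w]], so only [m = j] is left. *)
  have mj : m = j.
    by case: (ltngtP m j) => // h; try lia; have := maxw m; rewrite /P clm; lia.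
  rewrite {}mj in mn pm nim him cr clm cl3.
  have [|s1] : reducible e \/ small_interval i p; [by apply: sub => //; lia | by left |].
  have [|s2] : reducible e \/ small_interval p x; [by apply: sub => //; lia | by left |].
  have [|s3] : reducible e \/ small_interval x j; [by apply: sub => //; lia | by left |].
  exact: (crossing_reducible cr jn ix pm).
move=> /existsPn nix.
(* An edge from the interior back to some [m < w] would enter the interior of [[i, w]] from outside,
   unless [m = i], which [nix] excludes. *)
have clwj : closed_interval w j.
  apply/closed_intervalP => // x m wxj mn xm.
  have := clP x m _ mn xm => /(_ _)/wrap[|him]; first by lia.
  have [|mw] := leqP w m; first by lia.
  rewrite ed_sym in xm; have xn : x < n by lia.
  have [im|mi] := ltnP i m.
    by have := closed_intervalP _ wn clw m x _ xn xm; lia.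
  have mE : m = i by lia.
  by have := nix (Ordinal xn); rewrite /= -mE xm wxj.
have [|s1] : reducible e \/ small_interval i w; [by apply: sub => //; lia | by left |].
have [|s2] : reducible e \/ small_interval w j; [by apply: sub => //; lia | by left |].
exact: (closed_split iwj).
Qed.

Lemma end_block_reducible : 1 < n -> reducible e.
Proof.
move=> n1.
have cl : closed_interval 0 n.-1.
  by apply/closed_intervalP => [|k m]; lia.
have [|||s] := closed_reducible_or_small _ _ cl; try lia; first by [].
(* Unlike [v 0], the last vertex has all its neighbours in the block. For length 1 its degree
   contradicts [min_deg]; for lengths 2 and 3 it completes (a) and (d). *)
have dlast : d (v n.-1) <= n.-1.
  rewrite -[leqRHS](size_iota 0); apply: nbr_deg => [|m mn lm]; first by lia.
  by have := ed_neq lm; rewrite mem_iota; lia.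
case: s => [nE|nE|[nE D]]; rewrite nE in cl dlast.
- by have := min_deg (v 1); lia.
- have lt2 : 2 < n by lia.
  have [d1 _ e12] := closed_ear lt2 cl.
  by apply: (ear_reducible e_sym d1 (w := v 2)); [rewrite e_sym | lia].
- by apply: (diamond_reducible4 D); lia.
Qed.

End Intervals.

(** * End blocks *)

Section EndBlock.
Variables (T : finType) (e : rel T).
Hypotheses (e_sym : symmetric e) (e_irr : irreflexive e).

(** Take for [D] the component of a vertex that is not connected to [r]. *)
Lemma disconnected_in (A : {set T}) r : ~~ connected_in e A -> r \in A ->
  exists D : {set T}, [/\ D != finset.set0, D \subset A, r \notin D &
    {in D & A, forall x y, e x y -> y \in D}].
Proof.
have isym : symmetric (induced e A).
  by move=> x y; rewrite /induced /= e_sym andbCA.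
have csym := sym_connect_sym isym.
move=> ncA rA.
suff [y yA nry] : exists2 y, y \in A & ~~ connect (induced e A) y r.
  exists [set w in A | connect (induced e A) y w]; split.
  - by apply/set0Pn; exists y; rewrite inE yA connect0.
  - by apply/subsetP => w; rewrite inE => /andP[].
  - by rewrite inE negb_and nry orbT.
  - move=> x w; rewrite !inE => /andP[xA yx] wA xw; rewrite wA.
    by apply: connect_trans yx _; apply: connect1; rewrite /induced /= xA wA.
apply/exists_inP; apply: contraR ncA => /exists_inPn h.
apply/forall_inP => x xA; apply/forall_inP => y yA.
have := h x xA; have := h y yA; rewrite !negbK => yr xr.
by apply: connect_trans xr _; rewrite csym.
Qed.

(* [C] is a union of components of the graph without [z]; a smallest such [C],
   over all [z], makes [z |: C] an end block. *)
Definition leaf_set (z : T) (C : {set T}) : bool :=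
  [&& z \notin C, C != finset.set0 &
      [forall x in C, forall y, e x y ==> (y \in z |: C)]].

Lemma leaf_setP z (C : {set T}) :
  reflect [/\ z \notin C, C != finset.set0 &
              forall x y, x \in C -> e x y -> y \in z |: C] (leaf_set z C).
Proof.
apply: (iffP and3P) => -[zC C0 cl]; split=> //.
  by move=> x y xC xy; have /forall_inP/(_ x xC)/forallP/(_ y)/implyP := cl; apply.
by apply/forall_inP => x xC; apply/forallP => y; apply/implyP; apply: cl.
Qed.

Hypothesis min_deg : forall x, 2 <= deg e x.

Lemma exists_nbr x : exists y, e x y.
Proof.
have: 0 < deg e x by apply: leq_trans (min_deg x).
by case/card_gt0P => y; rewrite inE; exists y.
Qed.

Lemma exists_end_block : 0 < #|T| ->
  exists z, exists S : {set T}, [/\ block e S, z \in S, 1 < #|S| &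
    forall x y, x \in S -> x != z -> e x y -> y \in S].
Proof.
case/card_gt0P => z0 _.
pose P k := [exists z, exists C : {set T}, leaf_set z C && (#|C| == k)].
have exP : exists k, P k.
  exists #|[set~ z0]|; apply/existsP; exists z0; apply/existsP; exists [set~ z0].
  rewrite eqxx andbT; apply/leaf_setP; split.
  - by rewrite !inE eqxx.
  - have [y zy] := exists_nbr z0; apply/set0Pn; exists y; rewrite !inE.
    by apply: contraTneq zy => ->; rewrite e_irr.
  - by move=> x y _ _; rewrite !inE; case: eqP.
case: (ex_minnP exP) => k /existsP[z /existsP[C /andP[zC /eqP Ck]]] mink.
have minC z' (C' : {set T}) : leaf_set z' C' -> #|C| <= #|C'|.
  move=> h; rewrite Ck; apply: mink; apply/existsP; exists z'; apply/existsP.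
  by exists C'; rewrite h eqxx.
have /leaf_setP[znC C0 clC] := zC.
have [c cC] := set0Pn _ C0.
pose S := z |: C.
have zS : z \in S by rewrite !inE eqxx.
have cS : c \in S by rewrite !inE cC orbT.
have cz : c != z by apply: contraNneq znC => <-.
have clS x y : x \in S -> x != z -> e x y -> y \in S.
  by rewrite inE => /orP[/set1P->|xC]; [rewrite eqxx | move=> _; apply: clC].
have S1 : 1 < #|S|.
  by rewrite cardsU1 znC; have : 0 < #|C| by apply/card_gt0P; exists c.
exists z, S; split=> //.
(* A component of [C] missing [c] would be a smaller leaf set for the same [z]. *)
have conC : connected_in e C.
  apply/negPn/negP => /disconnected_in/(_ cC)[D [D0 DC cD clD]].
  have /minC : leaf_set z D.
    apply/leaf_setP; split=> //; first by apply: contra znC; apply: (subsetP DC).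
    move=> x y xD xy; have xC := subsetP DC x xD.
    have := clC x y xC xy; rewrite !inE => /orP[->//|yC].
    by rewrite (clD x y) ?orbT.
  by rewrite leqNgt proper_card // properE DC; apply/subsetPn; exists c.
(* A component of [S] without [z] is closed under adjacency; deleting any vertex [x] from it gives a
   leaf set for [x] that is smaller than [C]. *)
have conS : connected_in e S.
  apply/negPn/negP => /disconnected_in/(_ zS)[D [D0 DS zD clD]].
  have DC : D \subset C.
    apply/subsetP => x xD; have := subsetP DS x xD; rewrite !inE => /orP[/eqP xz|//].
    by rewrite -xz xD in zD.
  have clD' x y : x \in D -> e x y -> y \in D.
    move=> xD xy; apply: (clD x y) => //.
    by apply: (clC x) => //; apply: (subsetP DC).
  have [x xD] := set0Pn _ D0.
  have: leaf_set x (D :\ x).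
    apply/leaf_setP; split.
    - by rewrite !inE eqxx.
    - have [y xy] := exists_nbr x; apply/set0Pn; exists y; rewrite !inE (clD' x) // andbT.
      by apply: contraTneq xy => ->; rewrite e_irr.
    - by move=> u y; rewrite !inE => /andP[_ uD] /(clD' u y uD) ->; case: eqP.
  move/minC; rewrite leqNgt => /negP; apply.
  apply: leq_trans (subset_leq_card DC).
  by rewrite (cardsD1 x D) xD.
(* Without [z], the set [S] is [C]. For another cut vertex [w], a component of the rest that avoids
   [z] is a leaf set for [w] inside [C] without [w]. *)
have nsS : nonseparable e S.
  apply/and3P; split=> //; first by apply/set0Pn; exists z.
  apply/forallP => w; rewrite negb_and negbK; have [wS|//] /= := boolP (w \in S).
  have [->|wz] := eqVneq w z; first by rewrite /S setU1K.
  apply/negPn/negP => /disconnected_in ncSw.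
  have [|D [D0 DS zD clD]] := ncSw z; first by rewrite !inE eq_sym wz eqxx.
  have DC x : x \in D -> x \in C.
    move=> xD; have := subsetP DS x xD; rewrite !inE => /andP[_ /orP[/eqP xz|//]].
    by rewrite -xz xD in zD.
  have wD : w \notin D by apply/negP => /(subsetP DS); rewrite !inE eqxx.
  have /minC : leaf_set w D.
    apply/leaf_setP; split=> // x y xD xy; rewrite in_setU1.
    have [//|yw] /= := eqVneq y w.
    by apply: (clD x y) => //; rewrite in_setD1 yw (clC x) // DC.
  rewrite leqNgt proper_card // properE; apply/andP; split.
    by apply/subsetP => x; apply: DC.
  apply/subsetPn; exists w => //.
  by move: wS; rewrite in_setU1 (negPf wz).
(* If [B] is nonseparable and contains [S], then [B] without [z] is connected and none of its edges
   leaves [C], so it equals [C]. *)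
apply/maxsetP; split=> // B nsB SB.
apply/eqP; rewrite eqEsubset SB andbT; apply/subsetP => x xB.
have [xz|xz] := eqVneq x z; first by rewrite xz.
have /and3P[_ _ /forallP/(_ z)] := nsB.
rewrite negb_and negbK (subsetP SB z zS) /= => /forall_inP/(_ c).
rewrite in_setD1 cz (subsetP SB c cS) => /(_ isT)/forall_inP/(_ x).
rewrite in_setD1 xz xB => /(_ isT) cx.
have cl : closed (induced e (B :\ z)) (mem C).
  apply: (intro_closed (sym_connect_sym _)).
    by move=> p q; rewrite /induced /= e_sym andbCA.
  move=> p q; rewrite /induced /= !in_setD1 => /and3P[/andP[pz pB] /andP[qz _] pq] pC.
  by have := clC p q pC pq; rewrite in_setU1 (negPf qz).
by have := closed_connect cl cx; rewrite /= cC in_setU1 => <-; rewrite orbT.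
Qed.

End EndBlock.

(** * The Poincare-Miranda theorem in the plane *)

From mathcomp Require Import boolp classical_sets interval_inference.
From mathcomp Require Import topology normedtype.
Import Order.TTheory GRing.Theory Num.Theory.
Import numFieldNormedType.Exports.

(** * Sign changes on a grid, by parity *)

Section Grid.
Variables (n : nat) (A B : nat -> nat -> bool).

Definition cell_mixed (F : nat -> nat -> bool) (i j : nat) : bool :=
  [|| F i j, F i.+1 j, F i j.+1 | F i.+1 j.+1] &&
  ~~ [&& F i j, F i.+1 j, F i j.+1 & F i.+1 j.+1].

(* On the border, [E] holds an odd number of times, all on the side [i = 0];
   around a cell in which [A] or [B] is constant it holds an even number of
   times. *)
Let E i j i' j' : bool := [&& ~~ A i j, ~~ A i' j' & B i j (+) B i' j'].
Let V i m : bool := \big[addb/false]_(0 <= j < m) E i j i j.+1.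

Let cell_even i j : ~~ (cell_mixed A i j && cell_mixed B i j) ->
  E i j i j.+1 (+) E i.+1 j i.+1 j.+1 = E i j i.+1 j (+) E i j.+1 i.+1 j.+1.
Proof.
rewrite /cell_mixed /E.
case: (A i j); case: (A i.+1 j); case: (A i j.+1); case: (A i.+1 j.+1) => //=;
case: (B i j); case: (B i.+1 j); case: (B i j.+1); by case: (B i.+1 j.+1).
Qed.

Lemma grid_mixed_cell : 0 < n ->
  (forall j, j <= n -> ~~ A 0 j) -> (forall j, j <= n -> A n j) ->
  (forall i, i <= n -> B i 0) -> (forall i, i <= n -> ~~ B i n) ->
  exists i j, [/\ i < n, j < n, cell_mixed A i j & cell_mixed B i j].
Proof.
move=> n0 A0 An B0 Bn; apply: contrapT => nex.
have even i j : i < n -> j < n ->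
    E i j i j.+1 (+) E i.+1 j i.+1 j.+1 = E i j i.+1 j (+) E i j.+1 i.+1 j.+1.
  move=> lti ltj; apply: cell_even; apply/negP => /andP[hA hB].
  by apply: nex; exists i, j.
have column i m : i < n -> m <= n -> V i m (+) V i.+1 m = E i 0 i.+1 0 (+) E i m i.+1 m.
  move=> lti; elim: m => [|m IH] lem; first by rewrite /V !big_geq // !addbb.
  rewrite /V !big_nat_recr //= -/(V i m) -/(V i.+1 m).
  rewrite addbACA even // IH //; last exact: ltnW.
  by rewrite -!addbA [E i m i.+1 m (+) (_ (+) _)]addbA addbb.
have Vconst i : i <= n -> V i n = V 0 n.
  elim: i => // i IH lti; rewrite -IH; last exact: ltnW.
  have := column i n lti (leqnn n).
  have -> : E i 0 i.+1 0 = false by rewrite /E !B0 ?andbF // ltnW.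
  have -> : E i n i.+1 n = false.
    by rewrite /E (negPf (Bn i (ltnW lti))) (negPf (Bn _ lti)) !andbF.
  by case: (V i n); case: (V i.+1 n).
have V0 m : m <= n -> V 0 m = B 0 0 (+) B 0 m.
  elim: m => [|m IH] lem; first by rewrite /V big_geq // addbb.
  rewrite /V big_nat_recr //= -/(V 0 m) IH ?(ltnW lem) //.
  rewrite /E !A0 ?(ltnW lem) //=.
  by rewrite -addbA [B 0 m (+) _]addbA addbb.
have Vn m : m <= n -> V n m = false.
  elim: m => [|m IH] lem; first by rewrite /V big_geq.
  by rewrite /V big_nat_recr //= -/(V n m) IH ?(ltnW lem) // /E An ?(ltnW lem).
have := Vconst n (leqnn n); rewrite Vn // V0 // B0 //.
by rewrite (negPf (Bn 0 _)).
Qed.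

End Grid.

(** * From the grid to the square, by compactness *)

Section PoincareMiranda.
Local Open Scope ring_scope.
Local Open Scope classical_set_scope.
Variable R : realType.
Local Notation I01 := (`[0%R, 1%R] : set R).
Local Notation K := (I01 `*` I01).

Let near_pos (G : R * R -> R) (x0 : R * R) :
  G x @[x --> within K (nbhs x0)] --> G x0 -> 0 < G x0 ->
  exists2 r : R, 0 < r & forall x, K x -> ball x0 r x -> 0 < G x.
Proof.
move=> /cvgr_gt/[apply]; rewrite near_withinE.
by move=> /nbhs_ballP[r r0 h]; exists r => // x Kx /h; apply.
Qed.

(** If there is no common zero, compactness gives one scale at which no point of the square sees
    both functions take both weak signs nearby; the grid of that mesh has a cell that contradicts
    this. *)
Lemma poincare_miranda (G1 G2 : R * R -> R) :
  {within K, continuous G1} -> {within K, continuous G2} ->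
  (forall t, I01 t -> G1 (0, t) <= 0) -> (forall t, I01 t -> 0 <= G1 (1, t)) ->
  (forall s, I01 s -> 0 <= G2 (s, 0)) -> (forall s, I01 s -> G2 (s, 1) <= 0) ->
  exists2 x, K x & G1 x = 0 /\ G2 x = 0.
Proof.
move=> /subspace_continuousP c1 /subspace_continuousP c2 l1 r1 b2 t2.
apply: contrapT => nz.
pose close (n : nat) (x y : R * R) :=
  `|x.1 - y.1| <= n.+1%:R^-1 /\ `|x.2 - y.2| <= n.+1%:R^-1.
pose mixed (n : nat) (x : R * R) (G : R * R -> R) :=
  (exists2 y, K y /\ close n x y & 0 <= G y) /\
  (exists2 y, K y /\ close n x y & G y <= 0).
pose P n x := ~ (mixed n x G1 /\ mixed n x G2).
(* Continuity fixes the sign of [G] on a ball of radius [r]; half of [r] is spent on the choice of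
   [x], the other half on the mesh. *)
have nearG (G : R * R -> R) x0 : K x0 ->
    (forall x, K x -> G x @[x --> within K (nbhs x)] --> G x) -> G x0 != 0 ->
    \forall x \near x0 & n \near \oo, ~ mixed n x G.
  move=> Kx0 cG G0.
  have [r r0 hr] : exists2 r : R, 0 < r &
      forall x y, K x -> K y -> ball x0 r x -> ball x0 r y ->
      ~ (0 <= G x /\ G y <= 0).
    have [Gp|Gn] : 0 < G x0 \/ 0 < - G x0.
        by rewrite oppr_gt0; move: G0; rewrite neq_lt => /orP[]; [right|left].
      have [r r0 h] := near_pos (cG _ Kx0) Gp.
      exists r => // x y Kx Ky _ /(h y Ky) Gy [_].
      by rewrite leNgt Gy.
    have cN : (fun x => - G x) x @[x --> within K (nbhs x0)] --> - G x0.
      by apply: cvgN; apply: cG.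
    have [r r0 h] := near_pos cN Gn; exists r => // x y Kx _ /(h x Kx) Gx _ [+ _].
    by rewrite leNgt -oppr_gt0 Gx.
  have r2 : 0 < r / 2 by rewrite divr_gt0.
  exists (ball x0 (r / 2), [set n | n.+1%:R^-1 < r / 2 :> R]).
    split; first exact: nbhsx_ballx.
    exact: (near_infty_natSinv_lt (PosNum r2)).
  move=> [x n] /= [[bx1 bx2] hn] [[y [Ky [cy1 cy2]] Gy] [y' [Ky' [cy1' cy2']] Gy']].
  have bb (w : R * R) : `|x.1 - w.1| <= n.+1%:R^-1 -> `|x.2 - w.2| <= n.+1%:R^-1 ->
      ball x0 r w.
    move=> h1 h2; split; rewrite /ball /=.
      have -> : x0.1 - w.1 = (x0.1 - x.1) + (x.1 - w.1) by ring.
      apply: le_lt_trans (ler_normD _ _) _.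
      rewrite [r]splitr; apply: ltrD; first exact: bx1.
      exact: le_lt_trans hn.
    have -> : x0.2 - w.2 = (x0.2 - x.2) + (x.2 - w.2) by ring.
    apply: le_lt_trans (ler_normD _ _) _.
    rewrite [r]splitr; apply: ltrD; first exact: bx2.
    exact: le_lt_trans hn.
  by apply: (hr y y') => //; apply: bb.
have cK : compact K by apply: compact_setX; apply: segment_compact.
have : \forall n \near \oo, K `<=` P n.
  move/compact_near_coveringP: cK; apply => x0 Kx0.
  have [G10|G10] := eqVneq (G1 x0) 0.
    have G20 : G2 x0 != 0 by apply/eqP => G20; apply: nz; exists x0.
    by apply: filterS (nearG G2 x0 Kx0 c2 G20) => -[x n] /= h [_].
  by apply: filterS (nearG G1 x0 Kx0 c1 G10) => -[x n] /= h [].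
case=> n _ /(_ n (leqnn n)) KP.
pose x_ (i j : nat) : R * R := (i%:R / n.+1%:R, j%:R / n.+1%:R).
have I_ (i : nat) : (i <= n.+1)%N -> I01 (i%:R / n.+1%:R).
  move=> le; rewrite /= in_itv /= divr_ge0 //= ler_pdivrMr // mul1r.
  by rewrite ler_nat.
have Kx i j : (i <= n.+1)%N -> (j <= n.+1)%N -> K (x_ i j).
  by move=> hi hj; split; apply: I_.
(* The border values are imposed, because the sign conditions there are weak and [G1] or [G2] may
   vanish. *)
pose A i j := (i != 0%N) && ((i == n.+1) || (0 < G1 (x_ i j))).
pose B i j := (j != n.+1) && ((j == 0%N) || (0 < G2 (x_ i j))).
have x0E (j : nat) : x_ 0%N j = (0, j%:R / n.+1%:R) by rewrite /x_ mul0r.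
have xnE (j : nat) : x_ n.+1 j = (1, j%:R / n.+1%:R) by rewrite /x_ divff.
have xE0 (j : nat) : x_ j 0%N = (j%:R / n.+1%:R, 0) by rewrite /x_ mul0r.
have xEn (j : nat) : x_ j n.+1 = (j%:R / n.+1%:R, 1) by rewrite /x_ divff.
have AP i j : (i <= n.+1)%N -> (j <= n.+1)%N ->
    if A i j then 0 <= G1 (x_ i j) else G1 (x_ i j) <= 0.
  move=> hi hj; rewrite /A; have [->|i0] /= := eqVneq i 0%N.
    by rewrite x0E l1 //; apply: I_.
  have [->|i1] /= := eqVneq i n.+1; first by rewrite xnE r1 //; apply: I_.
  by case: ltP => // /ltW.
have BP i j : (i <= n.+1)%N -> (j <= n.+1)%N ->
    if B i j then 0 <= G2 (x_ i j) else G2 (x_ i j) <= 0.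
  move=> hi hj; rewrite /B; have [->|i0] /= := eqVneq j n.+1.
    by rewrite xEn t2 //; apply: I_.
  have [->|i1] /= := eqVneq j 0%N; first by rewrite xE0 b2 //; apply: I_.
  by case: ltP => // /ltW.
have [] := @grid_mixed_cell n.+1 A B => //.
- by move=> j _; rewrite /A /= eqxx.
- by move=> j _; rewrite /B /= eqxx.
move=> i [j [lti ltj mA mB]].
have mixP (F : nat -> nat -> bool) G :
    (forall i j, (i <= n.+1)%N -> (j <= n.+1)%N ->
      if F i j then 0 <= G (x_ i j) else G (x_ i j) <= 0) ->
    cell_mixed F i j -> mixed n (x_ i j) G.
  move=> FP /andP[Fpos Fneg].
  have cl (a b : bool) : K (x_ (i + a)%N (j + b)%N) /\
      close n (x_ i j) (x_ (i + a)%N (j + b)%N).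
    split; first by apply: Kx; [case: a|case: b]; rewrite ?addn1 ?addn0 // ltnW.
    have h (k : nat) (c : bool) :
        `|k%:R / n.+1%:R - (k + c)%:R / n.+1%:R| <= n.+1%:R^-1 :> R.
      rewrite -mulrBl normrM [`|n.+1%:R^-1|]ger0_norm ?invr_ge0 //.
      rewrite ler_piMl ?invr_ge0 // natrD opprD addNKr normrN.
      by case: c; rewrite /= ?normr0 ?normr1.
    by split; apply: h.
  have FP' (a b : bool) : if F (i + a)%N (j + b)%N then 0 <= G (x_ (i + a)%N (j + b)%N)
      else G (x_ (i + a)%N (j + b)%N) <= 0.
    by apply: FP; [case: a|case: b]; rewrite ?addn1 ?addn0 // ltnW.
  split.
    have [a [b Fab]] : exists a b : bool, F (i + a)%N (j + b)%N.
      by case/or4P: Fpos => h; [exists false, false | exists true, false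
        | exists false, true | exists true, true]; rewrite ?addn1 ?addn0.
    by exists (x_ (i + a)%N (j + b)%N) => //; have := FP' a b; rewrite Fab.
  have [a [b Fab]] : exists a b : bool, ~~ F (i + a)%N (j + b)%N.
    by move: Fneg; rewrite !negb_and => /or4P[] h; [exists false, false | exists true, false
      | exists false, true | exists true, true]; rewrite ?addn1 ?addn0.
  by exists (x_ (i + a)%N (j + b)%N) => //; have := FP' a b; rewrite (negPf Fab).
have /KP : K (x_ i j) by apply: Kx; apply: ltnW.
by apply; split; [apply: (mixP A) | apply: (mixP B)].
Qed.

End PoincareMiranda.

(** * Arcs in the disk *)

Section Arcs.
Local Open Scope ring_scope.
Local Open Scope classical_set_scope.
Variable R : realType.
Implicit Types p q r x y z : R * R.
Local Notation I01 := (`[0%R, 1%R] : set R).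
Local Notation K := (I01 `*` I01).

(** Twice the signed area of the triangle [p q r], positive when it runs counterclockwise. *)
Definition orient p q r : R :=
  (q.1 - p.1) * (r.2 - p.2) - (q.2 - p.2) * (r.1 - p.1).

(** For [p] on the circle and [x] in the disk, the distance from [x] to the tangent at [p]. *)
Definition depth p x : R := 1 - (p.1 * x.1 + p.2 * x.2).

Lemma depthE p x : on_unit_circle p ->
  depth p x = (1 - (x.1 ^+ 2 + x.2 ^+ 2) + (p.1 - x.1) ^+ 2 + (p.2 - x.2) ^+ 2) / 2.
Proof. by rewrite /on_unit_circle /depth => cp; lra. Qed.

Lemma depth_ge0 p x : on_unit_circle p -> in_unit_disk x -> 0 <= depth p x.
Proof.
move=> cp dx; rewrite depthE // divr_ge0 // addr_ge0 ?sqr_ge0 // addr_ge0 ?sqr_ge0 //.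
by rewrite subr_ge0.
Qed.

Lemma depth_eq0 p x : on_unit_circle p -> in_unit_disk x -> depth p x = 0 -> p = x.
Proof.
move=> cp; rewrite /in_unit_disk -subr_ge0 => dx; rewrite depthE // => h.
have := sqr_ge0 (p.1 - x.1); have := sqr_ge0 (p.2 - x.2) => h2 h1.
have /eqP : (p.1 - x.1) ^+ 2 = 0 by lra.
have /eqP : (p.2 - x.2) ^+ 2 = 0 by lra.
rewrite !sqrf_eq0 !subr_eq0 => /eqP e2 /eqP e1.
by rewrite [p]surjective_pairing e1 e2 -surjective_pairing.
Qed.

Lemma depth_circle p : on_unit_circle p -> depth p p = 0.
Proof. by rewrite /on_unit_circle /depth -!expr2 => ->; rewrite subrr. Qed.

Lemma depth_gt0 p x : on_unit_circle p -> in_unit_disk x -> p <> x -> 0 < depth p x.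
Proof.
move=> cp dx px; rewrite lt_neqAle depth_ge0 // andbT.
by apply/eqP => /esym/(depth_eq0 cp dx).
Qed.

Lemma circle_disk p : on_unit_circle p -> in_unit_disk p.
Proof. by rewrite /in_unit_disk => ->. Qed.

(* It vanishes iff [x] and [y] are on a line through the pole of the chord
   [pq]. *)
Definition depth_gap p q x y : R := depth p x * depth q y - depth p y * depth q x.

(** The vanishing gaps make the depths of [x] and [y] at [p1], [p2] and [p3] proportional with the
    one ratio [S x : S y]. As these three points are not collinear, this forces [x = y]. *)
Lemma depth_gap_eq0 p1 p2 p3 p4 x y :
  on_unit_circle p1 -> on_unit_circle p3 -> in_unit_disk x -> in_unit_disk y ->
  0 < orient p1 p2 p3 -> 0 < orient p1 p2 p4 ->
  0 < orient p1 p3 p4 -> 0 < orient p2 p3 p4 ->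
  depth_gap p1 p3 x y = 0 -> depth_gap p2 p4 x y = 0 -> x = y.
Proof.
move=> c1 c3 dx dy o123 o124 o134 o234 /subr0_eq G1 /subr0_eq G2.
pose S w := orient p2 p3 p4 * depth p1 w + orient p1 p2 p4 * depth p3 w.
(* Both sides come from the affine dependency of [p1, p2, p3, p4]: [S] is
   proportional to the distance to the polar of the meeting point of the
   chords [p1 p3] and [p2 p4]. *)
have S' w : S w = orient p1 p3 p4 * depth p2 w + orient p1 p2 p3 * depth p4 w.
  by rewrite /S /orient /depth; ring.
have p13 : p1 <> p3 by move=> E; move: o123; rewrite E /orient; lra.
have Spos w : in_unit_disk w -> 0 < S w.
  move=> dw; have h1 := depth_ge0 c1 dw; have h3 := depth_ge0 c3 dw.
  have [E|ne] := eqVneq (depth p1 w) 0.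
    have w3 : p3 <> w by rewrite -(depth_eq0 c1 dw E) => /esym.
    by rewrite /S E mulr0 add0r mulr_gt0 // depth_gt0.
  by rewrite /S ltr_wpDr // ?mulr_ge0 ?(ltW o124) // mulr_gt0 // lt_neqAle eq_sym ne.
have Sx := Spos x dx; have Sy := Spos y dy.
have e1 : S y * depth p1 x = S x * depth p1 y.
  by rewrite /S !mulrDl -!mulrA [depth p3 y * _]mulrC G1; ring.
have e3 : S y * depth p3 x = S x * depth p3 y.
  by rewrite /S !mulrDl -!mulrA -G1; ring.
have e2 : S y * depth p2 x = S x * depth p2 y.
  by rewrite !S' !mulrDl -!mulrA [depth p4 y * _]mulrC G2; ring.
(* The proportions say that [(u1, u2)] has inner product [S y - S x] with each of [p1], [p2] and
   [p3]; by elimination it is zero, and so is [S y - S x]. *)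
pose u1 := S y * x.1 - S x * y.1; pose u2 := S y * x.2 - S x * y.2.
have eq i : S y * depth i x = S x * depth i y -> S y - S x = i.1 * u1 + i.2 * u2.
  by rewrite /depth /u1 /u2 => h; lra.
have {}e1 := eq _ e1; have {}e2 := eq _ e2; have {}e3 := eq _ e3.
have o0 : orient p1 p2 p3 != 0 by rewrite gt_eqF.
have u10 : u1 = 0.
  apply: (mulfI o0); rewrite mulr0 /orient.
  have -> : ((p2.1 - p1.1) * (p3.2 - p1.2) - (p2.2 - p1.2) * (p3.1 - p1.1)) * u1 =
    (p3.2 - p1.2) * ((p2.1 * u1 + p2.2 * u2) - (p1.1 * u1 + p1.2 * u2)) -
    (p2.2 - p1.2) * ((p3.1 * u1 + p3.2 * u2) - (p1.1 * u1 + p1.2 * u2)) by ring.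
  by rewrite -e1 -e2 -e3; ring.
have u20 : u2 = 0.
  apply: (mulfI o0); rewrite mulr0 /orient.
  have -> : ((p2.1 - p1.1) * (p3.2 - p1.2) - (p2.2 - p1.2) * (p3.1 - p1.1)) * u2 =
    (p2.1 - p1.1) * ((p3.1 * u1 + p3.2 * u2) - (p1.1 * u1 + p1.2 * u2)) -
    (p3.1 - p1.1) * ((p2.1 * u1 + p2.2 * u2) - (p1.1 * u1 + p1.2 * u2)) by ring.
  by rewrite -e1 -e2 -e3; ring.
have Sxy : S y = S x by apply/eqP; rewrite -subr_eq0 e1 u10 u20 !mulr0 addr0.
have S0 : S x != 0 by rewrite gt_eqF.
rewrite [x]surjective_pairing [y]surjective_pairing; congr pair; apply: (mulfI S0).
  by apply/eqP; rewrite -subr_eq0 -{1}Sxy -/u1 u10.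
by apply/eqP; rewrite -subr_eq0 -{1}Sxy -/u2 u20.
Qed.

Lemma depth_gap_continuous p q (f g : R -> R * R) :
  {within I01, continuous f} -> {within I01, continuous g} ->
  {within K, continuous (fun w => depth_gap p q (f w.1) (g w.2))}.
Proof.
move=> /subspace_continuousP cf /subspace_continuousP cg.
apply/subspace_continuousP => -[s t] [/= Is It].
have cs : f w.1 @[w --> within K (nbhs (s, t))] --> f s.
  have h1 : w.1 @[w --> within K (nbhs (s, t))] --> within I01 (nbhs s).
    move=> U /nbhs_ballP[r r0 h]; apply/nbhs_ballP.
    by exists r => // -[s' t'] [/= bs bt] [Is' It']; apply: h.
  exact: cvg_comp h1 (cf s Is).
have ct : g w.2 @[w --> within K (nbhs (s, t))] --> g t.
  have h2 : w.2 @[w --> within K (nbhs (s, t))] --> within I01 (nbhs t).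
    move=> U /nbhs_ballP[r r0 h]; apply/nbhs_ballP.
    by exists r => // -[s' t'] [/= bs bt] [Is' It']; apply: h.
  exact: cvg_comp h2 (cg t It).
have c1 (F : R * R -> R * R) (l : R * R) : F w @[w --> within K (nbhs (s, t))] --> l ->
    (F w).1 @[w --> within K (nbhs (s, t))] --> l.1.
  case: l => l1 l2 h; have hl : w.1 @[w --> (l1, l2)] --> l1 by exact: cvg_fst.
  exact: cvg_comp h hl.
have c2 (F : R * R -> R * R) (l : R * R) : F w @[w --> within K (nbhs (s, t))] --> l ->
    (F w).2 @[w --> within K (nbhs (s, t))] --> l.2.
  case: l => l1 l2 h; have hl : w.2 @[w --> (l1, l2)] --> l2 by exact: cvg_snd.
  exact: cvg_comp h hl.
have cd a (F : R * R -> R * R) (l : R * R) : F w @[w --> within K (nbhs (s, t))] --> l ->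
    depth a (F w) @[w --> within K (nbhs (s, t))] --> depth a l.
  move=> h; apply: cvgB; first exact: cvg_cst.
  by apply: cvgD; apply: cvgM; try exact: cvg_cst; [apply: c1 | apply: c2].
by apply: cvgB; apply: cvgM; apply: cd.
Qed.

(** At either end of an arc one of the two products in its gap vanishes, and the other is a product
    of nonnegative depths: this gives the border signs for the Poincare-Miranda theorem. *)
Lemma arcs_meet p1 p2 p3 p4 (A B : set (R * R)) :
  on_unit_circle p1 -> on_unit_circle p2 -> on_unit_circle p3 -> on_unit_circle p4 ->
  0 < orient p1 p2 p3 -> 0 < orient p1 p2 p4 ->
  0 < orient p1 p3 p4 -> 0 < orient p2 p3 p4 ->
  simple_arc p1 p3 A -> simple_arc p2 p4 B ->
  (forall x, A x -> in_unit_disk x) -> (forall x, B x -> in_unit_disk x) ->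
  exists x, A x /\ B x.
Proof.
move=> c1 c2 c3 c4 o123 o124 o134 o234 [f [cf _ f0 f1 ->]] [g [cg _ g0 g1 ->]] dA dB.
have df s : I01 s -> in_unit_disk (f s) by move=> Is; apply: dA; exists s.
have dg s : I01 s -> in_unit_disk (g s) by move=> Is; apply: dB; exists s.
have [||||[s t] [/= Is It] [G1 G2]] := poincare_miranda
  (depth_gap_continuous (p := p1) (q := p3) cf cg)
  (depth_gap_continuous (p := p2) (q := p4) cf cg).
- move=> t It; rewrite /= f0 /depth_gap depth_circle // mul0r sub0r oppr_le0.
  by rewrite mulr_ge0 // depth_ge0 //; [apply: dg | apply: circle_disk].
- move=> t It; rewrite /= f1 /depth_gap (depth_circle c3) mulr0 subr0.
  by rewrite mulr_ge0 // depth_ge0 //; [apply: circle_disk | apply: dg].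
- move=> s Is; rewrite /= g0 /depth_gap (depth_circle c2) mul0r subr0.
  by rewrite mulr_ge0 // depth_ge0 //; [apply: df | apply: circle_disk].
- move=> s Is; rewrite /= g1 /depth_gap (depth_circle c4) mulr0 sub0r oppr_le0.
  by rewrite mulr_ge0 // depth_ge0 //; [apply: circle_disk | apply: df].
exists (f s); split; first by exists s.
exists t => //; apply/esym.
by apply: (depth_gap_eq0 c1 c3 (df s Is) (dg t It) o123 o124 o134 o234).
Qed.

(* Stereographic coordinate from [z]; it increases counterclockwise, from
   [-oo] to [+oo], as the point runs through the circle without [z]. *)
Definition stereo z p : R := (z.2 * p.1 - z.1 * p.2) / depth z p.

(** * Points of the circle in stereographic coordinates *)

Section Stereo.
Variable z : R * R.
Hypothesis cz : on_unit_circle z.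

(** The inverse projection: [p] in the orthonormal frame [z], [(z.2, - z.1)], where [depth z p] is
    [2 / (1 + t ^+ 2)] for the coordinate [t] of [p]. *)
Let stereoP p : on_unit_circle p -> z <> p ->
  [/\ 0 < depth z p, depth z p * (1 + stereo z p ^+ 2) = 2,
      p.1 = z.1 * (1 - depth z p) + z.2 * (stereo z p * depth z p) &
      p.2 = z.2 * (1 - depth z p) - z.1 * (stereo z p * depth z p)].
Proof.
move=> cp zp; have d0 := depth_gt0 cz (circle_disk cp) zp.
have dn : depth z p != 0 by rewrite gt_eqF.
have E : stereo z p * depth z p = z.2 * p.1 - z.1 * p.2 by rewrite /stereo divfK.
split=> //; last 2 first.
- rewrite E /depth; transitivity (p.1 * (z.1 ^+ 2 + z.2 ^+ 2)); last by ring.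
  by rewrite cz mulr1.
- rewrite E /depth; transitivity (p.2 * (z.1 ^+ 2 + z.2 ^+ 2)); last by ring.
  by rewrite cz mulr1.
apply: (mulfI dn).
have -> : depth z p * (depth z p * (1 + stereo z p ^+ 2)) =
    depth z p ^+ 2 + (stereo z p * depth z p) ^+ 2 by ring.
rewrite E /depth; apply/eqP; rewrite -subr_eq0; apply/eqP.
transitivity ((z.1 ^+ 2 + z.2 ^+ 2) * (p.1 ^+ 2 + p.2 ^+ 2) - 1); last first.
  by rewrite cz cp mulr1 subrr.
by ring.
Qed.

Lemma stereo_inj p q : on_unit_circle p -> on_unit_circle q -> z <> p -> z <> q ->
  stereo z p = stereo z q -> p = q.
Proof.
move=> cp cq zp zq E.
have [_ wp p1 p2] := stereoP cp zp; have [_ wq q1 q2] := stereoP cq zq.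
have D : depth z p = depth z q.
  have t0 : 1 + stereo z q ^+ 2 != 0 by rewrite gt_eqF // ltr_pwDl // sqr_ge0.
  by apply: (mulIf t0); rewrite wq -wp E.
by rewrite [p]surjective_pairing [q]surjective_pairing p1 p2 q1 q2 E D.
Qed.

Lemma orient_stereo0 q r : on_unit_circle q -> on_unit_circle r ->
  z <> q -> z <> r -> stereo z q < stereo z r -> 0 < orient z q r.
Proof.
move=> cq cr zq zr lt.
have [wq _ q1 q2] := stereoP cq zq; have [wr _ r1 r2] := stereoP cr zr.
have -> : orient z q r = (z.1 ^+ 2 + z.2 ^+ 2) *
    (depth z q * depth z r * (stereo z r - stereo z q)).
  by rewrite /orient q1 q2 r1 r2; ring.
by rewrite cz mul1r !mulr_gt0 // subr_gt0.
Qed.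

(** Up to positive factors, the orientation is the Vandermonde product of the three coordinates. *)
Lemma orient_stereo p q r : on_unit_circle p -> on_unit_circle q ->
  on_unit_circle r -> z <> p -> z <> q -> z <> r ->
  stereo z p < stereo z q -> stereo z q < stereo z r -> 0 < orient p q r.
Proof.
move=> cp cq cr zp zq zr lt1 lt2.
have [wp wp2 p1 p2] := stereoP cp zp.
have [wq wq2 q1 q2] := stereoP cq zq; have [wr wr2 r1 r2] := stereoP cr zr.
have wE a t : a * (1 + t ^+ 2) = 2 -> a = 2 / (1 + t ^+ 2) :> R.
  by move=> <-; rewrite mulfK // gt_eqF // ltr_pwDl // sqr_ge0.
have t0 (t : R) : 1 + t ^+ 2 != 0 by rewrite gt_eqF // ltr_pwDl // sqr_ge0.
have -> : orient p q r = (z.1 ^+ 2 + z.2 ^+ 2) *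
    (depth z p * depth z q * depth z r * ((stereo z q - stereo z p) *
     (stereo z r - stereo z p) * (stereo z r - stereo z q)) / 2).
  rewrite /orient p1 p2 q1 q2 r1 r2 (wE _ _ wp2) (wE _ _ wq2) (wE _ _ wr2).
  by field; rewrite !t0.
have lt3 := lt_trans lt1 lt2.
by rewrite cz mul1r divr_gt0 // !mulr_gt0 // subr_gt0.
Qed.

End Stereo.
End Arcs.

(** * Circular order of an end block *)

Section CircularOrder.
Variables (R : realType) (T : finType) (S : {set T}) (z : T) (pos : T -> R * R).
Hypotheses (zS : z \in S) (pos_circ : {in S, forall x, on_unit_circle (pos x)}).
Hypothesis pos_injS : {in S &, injective pos}.

(** The vertex [z] gets index 0, and sorting by [stereo] from [pos z] lists the others
    counterclockwise after it. *)
Definition circular_seq : seq T :=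
  z :: sort (fun x y => stereo (pos z) (pos x) <= stereo (pos z) (pos y))%R
            (enum (S :\ z)).

Local Notation v i := (nth z circular_seq i).

Lemma mem_circular_seq : circular_seq =i S.
Proof.
move=> x; rewrite inE mem_sort mem_enum in_setD1.
by case: eqP => [->|]; rewrite ?zS.
Qed.

Lemma uniq_circular_seq : uniq circular_seq.
Proof. by rewrite /= mem_sort mem_enum in_setD1 eqxx sort_uniq enum_uniq. Qed.

Lemma size_circular_seq : size circular_seq = #|S|.
Proof. by rewrite -(card_uniqP uniq_circular_seq); apply: eq_card mem_circular_seq. Qed.

Lemma circular_seq_in m : m < size circular_seq -> v m \in S.
Proof. by move=> mn; rewrite -mem_circular_seq mem_nth. Qed.

Lemma circular_seq_eq i j : i < size circular_seq -> j < size circular_seq ->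
  (v i == v j) = (i == j).
Proof. by move=> hi hj; rewrite nth_uniq ?uniq_circular_seq. Qed.

Lemma circular_seq_orient i j k : i < j -> j < k -> k < size circular_seq ->
  (0 < orient (pos (v i)) (pos (v j)) (pos (v k)))%R.
Proof.
move=> ij jk kn.
have jn := ltn_trans jk kn; have i_n := ltn_trans ij jn.
have vS := circular_seq_in.
have vz m : 0 < m -> m < size circular_seq -> pos z <> pos (v m).
  move=> m0 mn /(pos_injS zS (vS m mn)) /eqP.
  rewrite -{1}[z]/(v 0) nth_uniq ?uniq_circular_seq //.
  by rewrite eq_sym (gtn_eqF m0).
have lt a b : 0 < a -> a < b -> b < size circular_seq ->
    (stereo (pos z) (pos (v a)) < stereo (pos z) (pos (v b)))%R.
  move=> a0 ab bn; have an := ltn_trans ab bn; have b0 := ltn_trans a0 ab.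
  rewrite lt_neqAle; apply/andP; split.
    apply/eqP => /(stereo_inj (pos_circ zS) (pos_circ (vS a an)) (pos_circ (vS b bn))
      (vz a a0 an) (vz b b0 bn)) /(pos_injS (vS a an) (vS b bn)) /eqP.
    by rewrite nth_uniq ?uniq_circular_seq // (ltn_eqF ab).
  case: a a0 ab an => // a _ ab an; case: b ab bn {b0} => // b ab bn /=.
  have tr : transitive (fun x y => stereo (pos z) (pos x) <= stereo (pos z) (pos y))%R.
    by move=> x y w; apply: le_trans.
  apply: (sorted_ltn_nth tr) => //; apply: sort_sorted => x y; exact: le_total.
case: i ij i_n => [|i] ij i_n.
  apply: orient_stereo0; try exact: pos_circ zS; try exact: pos_circ (vS _ _).
  - exact: vz.
  - by apply: vz => //; apply: ltn_trans jk.
  - exact: lt.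
apply: (@orient_stereo _ (pos z)); try exact: pos_circ zS; try exact: pos_circ (vS _ _).
- exact: vz.
- by apply: vz => //; apply: ltn_trans ij.
- by apply: vz => //; apply: ltn_trans jk; apply: ltn_trans ij.
- exact: lt.
- by apply: lt => //; apply: ltn_trans ij.
Qed.

Variables (e : rel T) (curve : {set T} -> set (R * R)).

Lemma circular_seq_edge i j : i < size circular_seq -> j < size circular_seq ->
  e (v i) (v j) -> [set v i; v j] \in edges_in e S.
Proof.
by move=> hi hj ij; apply/imset2P; exists (v i) (v j); rewrite ?inE ?circular_seq_in.
Qed.

Hypothesis drawing : circle_drawing e S pos curve.

(** The arcs meet by [arcs_meet]. The four ends are distinct and an arc contains no vertex of [S]
    except its own ends, so the meeting point is not a vertex. *)
Lemma interleaved_crosses a c b d :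
  a < size circular_seq -> c < size circular_seq ->
  b < size circular_seq -> d < size circular_seq ->
  e (v a) (v c) -> e (v b) (v d) -> interleaved a c b d ->
  crosses S pos curve [set v a; v c] [set v b; v d].
Proof.
move=> an cn bn dn ac bd il.
have vS := circular_seq_in.
have veq := circular_seq_eq.
have edge := circular_seq_edge.
have disj w : w \in [set v a; v c] -> w \in [set v b; v d] -> False.
  rewrite !inE => /orP[]/eqP-> /orP[]; rewrite veq // => /eqP E; move: il;
  by rewrite E /interleaved; lia.
have meet i k j l : i < j -> j < k -> k < l -> l < size circular_seq ->
    e (v i) (v k) -> e (v j) (v l) ->
    exists x, curve [set v i; v k] x /\ curve [set v j; v l] x.
  move=> ij jk kl ln ik jl.
  have kn := ltn_trans kl ln; have jn := ltn_trans jk kn; have i_n := ltn_trans ij jn.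
  apply: (@arcs_meet _ (pos (v i)) (pos (v j)) (pos (v k)) (pos (v l)));
    try exact: pos_circ (vS _ _); try (apply: circular_seq_orient => //).
  - exact: ltn_trans kl.
  - exact: ltn_trans jk.
  - by apply: (curve_arc drawing) => //; apply: vS.
  - by apply: (curve_arc drawing) => //; apply: vS.
  - by apply: (curve_disk drawing); apply: edge.
  - by apply: (curve_disk drawing); apply: edge.
split.
  by move=> E; apply: (disj (v a)); rewrite -?E !inE eqxx.
have [x [xac xbd]] : exists x, curve [set v a; v c] x /\ curve [set v b; v d] x.
  case/orP: il => /and3P[h1 h2 h3]; first exact: meet.
  by have [x [? ?]] := meet b d a c h1 h2 h3 cn bd ac; exists x.
exists x; split=> // w wS wx; rewrite -wx in xac xbd.
by apply: (disj w); [apply: (curve_vertex drawing (edge _ _ an cn ac))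
                    | apply: (curve_vertex drawing (edge _ _ bn dn bd))].
Qed.

Lemma drawing_one_crossing :
  {in edges_in e S & &, forall E F F', crosses S pos curve E F ->
     crosses S pos curve E F' -> F = F'} ->
  forall a c b d b' d',
  a < size circular_seq -> c < size circular_seq -> b < size circular_seq ->
  d < size circular_seq -> b' < size circular_seq -> d' < size circular_seq ->
  e (v a) (v c) -> e (v b) (v d) -> e (v b') (v d') -> b < d -> b' < d' ->
  interleaved a c b d -> interleaved a c b' d' -> b = b' /\ d = d'.
Proof.
move=> one a c b d b' d' an cn bn dn bn' dn' ac bd bd' ltbd ltbd' il il'.
have vS := circular_seq_in.
have veq := circular_seq_eq.
have edge := circular_seq_edge.
have /setP E := one _ _ _ (edge _ _ an cn ac) (edge _ _ bn dn bd) (edge _ _ bn' dn' bd')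
  (interleaved_crosses an cn bn dn ac bd il) (interleaved_crosses an cn bn' dn' ac bd' il').
have := E (v b'); have := E (v d'); have := E (v b); have := E (v d).
by rewrite !inE !veq // !eqxx ?orbT; lia.
Qed.

End CircularOrder.

Theorem theorem2p3 (R : realType) (T : finType) (e : rel T)
    (e_sym : symmetric e) (e_irr : irreflexive e) (T_nonempty : (0 < #|T|)%N)
    (e_pop : pseudo_outerplanar R e)
    (min_deg : forall x : T, (2 <= deg e x)%N) :
  config_a e \/ config_b e \/ config_c e \/ config_d e \/
  config_e e \/ config_f e \/ config_g e.
Proof.
have [z [S [bS zS S1 nS]]] := exists_end_block e_sym e_irr min_deg T_nonempty.
have [pos [curve [drawing one]]] := e_pop S bS.
have circ := pos_circle drawing; have inj := pos_inj drawing.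
have szE := size_circular_seq pos zS; have uq := uniq_circular_seq S z pos.
have mS := mem_circular_seq pos zS.
apply: (@end_block_reducible T e e_sym e_irr min_deg (size (circular_seq S z pos))
  (fun i => nth z (circular_seq S z pos) i)).
- move=> i j /= iN jN /eqP; rewrite nth_uniq // => /eqP //.
(* A vertex of positive index differs from [z], so its neighbours lie in the block. *)
- move=> k y /andP[k0 kn] ky; exists (index y (circular_seq S z pos)).
    rewrite index_mem mS; apply: nS ky; first by rewrite -mS mem_nth.
    by rewrite -[X in _ != X]/(nth z (circular_seq S z pos) 0) nth_uniq // -lt0n.
  rewrite nth_index // mS; apply: nS ky; first by rewrite -mS mem_nth.
  by rewrite -[X in _ != X]/(nth z (circular_seq S z pos) 0) nth_uniq // -lt0n.
- exact: (drawing_one_crossing zS circ inj drawing one).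
- by rewrite szE.
Qed.
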